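(* Let $\alpha$ be a real constant with $0<\alpha<1$, and let $\mathrm{p}_{n,\tau}(\alpha)$ be the probability that the stopping rule $\tau_n(\alpha)$, applied to a uniformly random ordering of $n$ totally ordered applicants, selects a pair of consecutive applicants whose ranks among all $n$ applicants differ by exactly one (the precise definitions are in the context). Then both limits below exist and \[\lim_{n\rightarrow\infty}\mathrm{p}_{n,\tau}(\alpha)\leq \lim_{n\rightarrow\infty}\mathrm{p}_{n,\tau}\left(\tfrac{1}{2}\right)=\tfrac{1}{2}.\]
   Context: Let $A_n$ be a totally ordered set of $n$ elements (called applicants), $n>3$. For $P\subseteq A_n$ and $x\in A_n$ let $\mathrm{rr}(P,x)=|\{z\in P\mid z\leq x\}|$ be the relative rank of $x$ with regard to $P$, and let $\mathrm{rr}_n(x)=\mathrm{rr}(A_n,x)$. Let $x_1,x_2,\dots,x_n$ be a uniformly random ordering of the $n$ distinct elements of $A_n$ (each of the $n!$ orderings is equally likely), and let $P_j=\{x_i\mid 1\leq i\leq j\}$. Stopping rule $\tau_n(\alpha)$, for real $0<\alpha<1$: reject the first $\alpha n$ applicants (that is, those $x_i$ with $i\leq \alpha n$), and then select the first pair of consecutive non-rejected applicants $x_{j-1},x_j$ (that is, the smallest $j\leq n$ with $j-1>\alpha n$) such that $\mathrm{rr}(P_j,x_{j-1})-\mathrm{rr}(P_j,x_j)\in\{-1,1\}$. If there is no such $j$, nothing is selected. $\mathrm{p}_{n,\tau}(\alpha)$ is the probability that $\tau_n(\alpha)$ selects a pair $x_{j-1},x_j$ and that this selected pair satisfies $\mathrm{rr}_n(x_{j-1})-\mathrm{rr}_n(x_j)\in\{-1,1\}$.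 *)

(* Defs.v *)
From HB Require Import structures.
From mathcomp Require Import all_boot all_order all_algebra.
From mathcomp Require Import all_classical all_reals all_analysis.
Set Implicit Arguments.
Unset Strict Implicit.
Unset Printing Implicit Defensive.
Import Order.TTheory GRing.Theory Num.Theory.
Local Open Scope ring_scope.

Section Ranks.
Context {d : Order.disp_t} {T : finOrderType d}.

Definition rr (P : {set T}) (x : T) : nat := #|[set z in P | (z <= x)%O]|.

Definition consecutive_in (P : {set T}) (x y : T) : bool :=
  (rr P x)%:Z - (rr P y)%:Z \in [:: -1; 1 : int].

End Ranks.

(* An ordering x_1, ..., x_n of T is an injective x : {ffun 'I_n -> T} (hence
   a bijection when #|T| = n). Positions are numbered from 0: x_i is the value
   of x at the ordinal i - 1. *)
Section StoppingRule.
Context {R : realType} {d : Order.disp_t} {T : finOrderType d} {n : nat}.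
Implicit Types (alpha : R) (x : {ffun 'I_n -> T}) (k : 'I_n).

Definition seen x k : {set T} := [set x i | i : 'I_n & (i <= k)%N].

(* With j = k + 1, the bound is j - 1 > alpha n and the pair is x_{j-1}, x_j.
   ord_pred is the cyclic predecessor; it is k - 1 as soon as 0 < k, which the
   bound ensures for alpha > 0. *)
Definition eligible alpha x k : bool :=
  (alpha * n%:R < k%:R) && consecutive_in (seen x k) (x (ord_pred k)) (x k).

(* The position of the second member of the selected pair, if any. *)
Definition tau alpha x : option 'I_n :=
  [pick k | eligible alpha x k
          & [forall i : 'I_n, (i < k)%N ==> ~~ eligible alpha x i]].

Definition success alpha x : bool :=
  if tau alpha x is Some k
  then consecutive_in [set: T] (x (ord_pred k)) (x k) else false.

End StoppingRule.

Definition orderings (n : nat) {d : Order.disp_t} (T : finOrderType d) :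
    {set {ffun 'I_n -> T}} :=
  [set x : {ffun 'I_n -> T} | injectiveb x].

Definition p_tau {R : realType} (n : nat) {d : Order.disp_t}
    (T : finOrderType d) (alpha : R) : R :=
  #|[set x in orderings n T | success alpha x]|%:R / #|orderings n T|%:R.

(* Main.v *)
Require Import Defs.
From HB Require Import structures.
From mathcomp Require Import all_boot all_order all_algebra all_fingroup.
From mathcomp Require Import all_classical all_reals all_analysis.
From mathcomp Require Import zify ring lra.

(* The last of n applicants falls uniformly into the n gaps left by the others,
   two of which make it rank-adjacent to its predecessor.  With the second
   members of pairs starting at position s (counted from 0), let M n count the
   orderings of n applicants in which no pair is adjacent on arrival and N n
   those in which the rule succeeds.  A new last applicant separates an already
   selected adjacent pair in just one position, so
     M (n + 1) = (n - 1) M n,   N (n + 1) = n N n + 2 M n,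
   whence N n = 2 s (n - s) (n - 2)!.  With s / n --> alpha, the probability
   N n / n! tends to 2 alpha (1 - alpha), which is maximal at alpha = 1/2. *)

Set Implicit Arguments.
Unset Strict Implicit.
Unset Printing Implicit Defensive.
Import Order.TTheory GRing.Theory Num.Theory.
Import numFieldNormedType.Exports.
Local Open Scope classical_set_scope.
Local Open Scope ring_scope.

(** * Invariance of relative ranks under increasing maps *)

Section Monotone.
Context {d d' : Order.disp_t} {T : finOrderType d} {T' : finOrderType d'}.
Variables (f : T -> T') (f_mono : {mono f : x y / (x <= y)%O}).

Lemma rr_mono (P : {set T}) (x : T) : rr (f @: P)%SET (f x) = rr P x.
Proof.
rewrite /rr -(card_imset (mem [set z in P | (z <= x)%O]%SET) (inc_inj f_mono)).
apply: eq_card => y; rewrite inE; apply/andP/imsetP.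
  move=> [/imsetP[z zP ->]]; rewrite f_mono => zx.
  by exists z; rewrite ?inE ?zP.
move=> [z]; rewrite inE => /andP[zP zx] ->.
by rewrite f_mono zx imset_f.
Qed.

Lemma consecutive_in_mono (P : {set T}) (x y : T) :
  consecutive_in (f @: P)%SET (f x) (f y) = consecutive_in P x y.
Proof. by rewrite /consecutive_in !rr_mono. Qed.

End Monotone.

(** * The stopping rule with an integer threshold *)

Section Meetings.
Context {d : Order.disp_t} {T : finOrderType d} {n : nat}.
Implicit Types (s : nat) (u : 'I_n -> T) (k : 'I_n).

(* [eligible] with the real bound [alpha * n < k] replaced by [s <= k]. *)
Definition meets s u k : bool :=
  (s <= k)%N &&
  consecutive_in [set u i | i : 'I_n & (i <= k)%N]%SET (u (ord_pred k)) (u k).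

Definition meets_first s u k : bool :=
  meets s u k && [forall i : 'I_n, (i < k)%N ==> ~~ meets s u i].

Definition never_meets s u : bool := [forall k, ~~ meets s u k].

Definition meets_well s u : bool :=
  [exists k, meets_first s u k
    && consecutive_in [set: T]%SET (u (ord_pred k)) (u k)].

Lemma meets_first_unique s u k k' :
  meets_first s u k -> meets_first s u k' -> k = k'.
Proof.
move=> /andP[mk /forallP fk] /andP[mk' /forallP fk'].
apply/val_inj; have [kk'|k'k|//] := ltngtP k k'.
  by have := fk' k; rewrite kk' mk.
by have := fk k'; rewrite k'k mk'.
Qed.

Lemma exists_meets_first s u : ~~ never_meets s u ->
  exists k, meets_first s u k.
Proof.
rewrite negb_forall => /existsP[k0]; rewrite negbK => mk0.
case: (arg_minnP (fun k : 'I_n => val k) mk0) => k mk kmin.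
exists k; rewrite /meets_first mk; apply/forallP => i; apply/implyP => ik.
by apply/negP => /kmin; rewrite leqNgt ik.
Qed.

(** At most one position is a first meeting, so [pick] has no choice to make and the option returned
    by [tau] can be replaced by an existential. *)
Lemma successE (R : realType) (alpha : R) s (x : {ffun 'I_n -> T}) :
  (forall k, (alpha * n%:R < k%:R) = (s <= k)%N) ->
  success alpha x = meets_well s x.
Proof.
move=> sP.
have el k : eligible alpha x k = meets s x k.
  by rewrite /eligible /meets sP /seen.
have fel k : eligible alpha x k
    && [forall i : 'I_n, (i < k)%N ==> ~~ eligible alpha x i]
    = meets_first s x k.
  by rewrite /meets_first el; congr andb; apply: eq_forallb => i; rewrite el.
rewrite /success /tau /meets_well; case: pickP => [k|nk].
  rewrite /= fel => fk; apply/idP/existsP => [sk|[k']].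
    by exists k; rewrite fk.
  by move=> /andP[/(meets_first_unique fk) <-].
by apply/esym/existsP => -[k /andP[fk _]]; have := nk k; rewrite /= fel fk.
Qed.

End Meetings.

(** The rule sees applicants only through comparisons; this lets ['I_n] stand for any order of [n]
    elements. *)
Lemma meets_well_mono {d d'} {T : finOrderType d} {T' : finOrderType d'} n s
    (f : T -> T') (u : 'I_n -> T) :
  {mono f : x y / (x <= y)%O} -> bijective f ->
  meets_well s (f \o u) = meets_well s u.
Proof.
move=> fm fb.
have el k : meets s (f \o u) k = meets s u k.
  by rewrite /meets -(consecutive_in_mono fm) -imset_comp.
rewrite /meets_well; apply: eq_existsb => k; congr andb.
  by rewrite /meets_first el; congr andb; apply: eq_forallb => i; rewrite el.
have -> : [set: T']%SET = (f @: [set: T])%SET.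
  have [g _ gK] := fb; apply/setP => y; rewrite inE; apply/esym/imsetP.
  by exists (g y); rewrite ?inE ?gK.
by rewrite -(consecutive_in_mono fm).
Qed.

Lemma consecutive_ordE n (a b : 'I_n) :
  consecutive_in [set: 'I_n]%SET a b
  = (a == b.+1 :> nat) || (b == a.+1 :> nat).
Proof.
have rrT (c : 'I_n) : rr [set: 'I_n]%SET c = c.+1.
  rewrite /rr -sum1dep_card.
  rewrite (eq_bigl (fun z : 'I_n => (z < c.+1)%N)); last first.
    by move=> z; rewrite inE.
  by rewrite (big_ord_narrow (ltn_ord c)) sum1_card card_ord.
by rewrite /consecutive_in !rrT !inE; lia.
Qed.

Lemma lift_mono n (j : 'I_n.+1) : {mono lift j : x y / (x <= y)%O}.
Proof. by move=> x y; rewrite !leEord /= leq_bump2. Qed.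

(** The cyclic predecessor depends on the size of the ordinal type only at 0, where it wraps
    around. *)
Lemma ord_pred_lift_max n (k : 'I_n) :
  (0 < k)%N -> ord_pred (lift ord_max k) = lift ord_max (ord_pred k).
Proof.
move=> k_gt0; apply/val_inj; rewrite [RHS]lift_max /=.
rewrite -[bump n k]/(val (lift ord_max k)).
rewrite [val _]lift_max.
have pk m : (k <= m)%N -> ((k + m).-1 %% m = k.-1)%N.
  move=> km; have -> : (k + m).-1 = (m + k.-1)%N by lia.
  by rewrite modnDl modn_small //; lia.
by rewrite !pk //; have := ltn_ord k; lia.
Qed.

(** * Appending a last applicant to a permutation *)

Section Insertion.
Variables (n s : nat) (s_gt0 : (0 < s)%N).
Implicit Types (j : 'I_n.+1) (q : 'S_n) (k : 'I_n).

(** [lift_perm ord_max j q] appends an applicant of value [j] to [q] and moves the earlier values by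
    the increasing map [lift j]. What is seen up to [k] is thus an increasing image of what [q]
    shows. *)
Lemma meets_lift j q k :
  meets s (lift_perm ord_max j q) (lift ord_max k) = meets s q k.
Proof.
rewrite /meets lift_max; case: leqP => //= sk.
rewrite ord_pred_lift_max ?(leq_trans s_gt0) // !lift_perm_lift.
rewrite -[RHS](consecutive_in_mono (@lift_mono n j)) -imset_comp.
congr consecutive_in; apply/setP => y; apply/imsetP/imsetP => -[i].
  rewrite inE => ik ->.
  have [i'|i_max] := unliftP ord_max i; last first.
    by move: ik; rewrite i_max /=; have := ltn_ord k; lia.
  move=> ii'; rewrite ii' lift_max in ik; exists i'; rewrite ?inE //.
  by rewrite ii' lift_perm_lift.
rewrite inE => ik ->; exists (lift ord_max i); rewrite ?inE ?lift_max //.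
by rewrite lift_perm_lift.
Qed.

Lemma meets_first_lift j q k :
  meets_first s (lift_perm ord_max j q) (lift ord_max k) = meets_first s q k.
Proof.
rewrite /meets_first meets_lift; congr andb.
apply/forallP/forallP => H i.
  by have := H (lift ord_max i); rewrite !lift_max meets_lift.
have [i' ->|->] := unliftP ord_max i; first by rewrite !lift_max meets_lift.
by rewrite lift_max ltnNge /= ltnW.
Qed.

Lemma never_meets_lift j q :
  never_meets s (lift_perm ord_max j q)
  = never_meets s q && ~~ meets s (lift_perm ord_max j q) ord_max.
Proof.
apply/forallP/andP => [H|[/forallP H Hmax] i].
  by split => //; apply/forallP => k; rewrite -(meets_lift j) H.
by have [i' ->|->] := unliftP ord_max i; rewrite ?meets_lift.
Qed.

(** A permutation amounts to its last value [j] together with the relative order [q] of the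
    others. *)
Lemma card_perm_lift (P : pred 'S_n.+1) :
  #|[set q | P q]%SET|
  = (\sum_(q : 'S_n) #|[set j | P (lift_perm ord_max j q)]%SET|)%N.
Proof.
rewrite -sum1dep_card big_mkcond /=.
pose h (x : 'S_n * 'I_n.+1) := lift_perm ord_max x.2 x.1.
have h_bij : bijective h.
  apply: inj_card_bij; last by rewrite card_prod card_ord !card_Sn factS mulnC.
  move=> [q j] [q' j']; rewrite /h /= => e.
  have jj' : j = j' by rewrite -(lift_perm_id ord_max j q) e lift_perm_id.
  rewrite -jj' in e *; congr pair; apply/permP => i; apply: (@lift_inj _ j).
  by rewrite -!(lift_perm_lift ord_max) e.
rewrite (reindex h (onW_bij _ h_bij)) /=.
rewrite -(pair_bigA _
  (fun q j => if P (lift_perm ord_max j q) then 1%N else 0%N)) /=.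
by apply: eq_bigr => q _; rewrite -sum1dep_card [RHS]big_mkcond.
Qed.

End Insertion.

Lemma card_pair_ord n a : (a < n)%N ->
  #|[set j : 'I_n.+1 | (j == a :> nat) || (j == a.+1 :> nat)]%SET| = 2.
Proof.
move=> an; have a0 : (a < n.+1)%N by lia.
rewrite (_ : [set j | _]%SET
  = [set Ordinal a0; Ordinal (an : a.+1 < n.+1)%N]%SET).
  by rewrite cards2 -val_eqE /= neq_ltn ltnS leqnn.
by apply/setP => j; rewrite !inE -!val_eqE.
Qed.

Lemma perm_image_max n (q : 'S_n.+1) :
  [set q i | i : 'I_n.+1 & (i <= (ord_max : 'I_n.+1))%N]%SET
  = [set: 'I_n.+1]%SET.
Proof.
apply/setP => y; rewrite inE; apply/imsetP.
by exists (q^-1 y)%g; rewrite ?permKV // inE -ltnS.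
Qed.

(** * Counting the values of the last applicant *)

Section LastInsertion.
Variables (m s : nat) (s_gt0 : (0 < s)%N) (le_s : (s <= m.+1)%N).
Implicit Types (j : 'I_m.+2) (q : 'S_m.+1).

(** At the last position everyone has been seen. The newcomer is adjacent to its predecessor when it
    takes that value, pushing the predecessor up, or the value just above. *)
Lemma meets_lift_max j q : meets s (lift_perm ord_max j q) ord_max
  = (j == q ord_max :> nat) || (j == (q ord_max).+1 :> nat).
Proof.
rewrite /meets le_s perm_image_max /=.
have -> : ord_pred (ord_max : 'I_m.+2) = lift ord_max ord_max.
  apply/val_inj; rewrite [RHS]lift_max /=.
  by rewrite [X in (X %% _)%N](addnC m m.+2) modnDl modn_small.
rewrite consecutive_ordE lift_perm_id lift_perm_lift /= /bump.
by case: leqP => /=; lia.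
Qed.

Lemma card_never_meets_lift q :
  #|[set j | never_meets s (lift_perm ord_max j q)]%SET|
  = (never_meets s q * m)%N.
Proof.
under eq_finset => j do rewrite never_meets_lift // meets_lift_max.
case: (never_meets s q) => /=; last by apply: eq_card0 => j; rewrite inE.
have := cardsC
  [set j : 'I_m.+2 | (j == q ord_max :> nat) || (j == (q ord_max).+1 :> nat)].
rewrite card_pair_ord // card_ord mul1n => /(@addnI 2 _ m); apply: etrans.
by apply: eq_card => j; rewrite !inE.
Qed.

(** If [q] never meets, only the new last pair can be selected, and two values of [j] make it
    adjacent. Otherwise the selection made in [q] stands, and [j] matters only by possibly
    separating that pair. *)
Lemma card_meets_well_lift q :
  #|[set j | meets_well s (lift_perm ord_max j q)]%SET|
  = (meets_well s q * m.+1 + never_meets s q * 2)%N.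
Proof.
have [nq|/exists_meets_first[k fk]] := boolP (never_meets s q).
  have -> : meets_well s q = false.
    apply/existsP => -[k /andP[/andP[mk _] _]].
    by move/forallP/(_ k): nq; rewrite mk.
  rewrite add0n mul1n; apply: etrans (card_pair_ord (ltn_ord (q ord_max))).
  apply: eq_card => j; rewrite !inE -meets_lift_max.
  apply/existsP/idP => [[i /andP[/andP[mi _] _]]|mj].
    move: mi; have [i' ->|-> //] := unliftP ord_max i.
    by rewrite meets_lift // (negbTE (forallP nq _)).
  exists ord_max; apply/andP; split; last first.
    by move: mj; rewrite /meets perm_image_max => /andP[_].
  rewrite /meets_first mj; apply/forallP => i; apply/implyP.
  have [i' ->|->] := unliftP ord_max i; last by rewrite ltnn.
  by rewrite meets_lift // (forallP nq).
have k_gt0 : (0 < k)%N.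
  by case/andP: fk => /andP[sk _] _; apply: leq_trans sk.
pose a := q (ord_pred k); pose b := q k.
have wq : meets_well s q = (a == b.+1 :> nat) || (b == a.+1 :> nat).
  rewrite -consecutive_ordE; apply/existsP/idP => [[i]|cab].
    by move=> /andP[/(meets_first_unique fk) <-].
  by exists k; rewrite fk.
have wl j : meets_well s (lift_perm ord_max j q)
    = (bump j a == (bump j b).+1) || (bump j b == (bump j a).+1).
  rewrite -[bump j a]/(val (lift j a)) -[bump j b]/(val (lift j b)).
  rewrite -consecutive_ordE /a /b -!(lift_perm_lift ord_max).
  rewrite -ord_pred_lift_max //.
  apply/existsP/idP => [[i]|cab]; last first.
    by exists (lift ord_max k); rewrite meets_first_lift // fk.
  have fk' : meets_first s (lift_perm ord_max j q) (lift ord_max k).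
    by rewrite meets_first_lift.
  by move=> /andP[/(meets_first_unique fk') <-].
rewrite mul0n addn0 wq; under eq_finset => j do rewrite wl.
have aE := ltn_ord a; have bE := ltn_ord b.
have [ab|/negbTE ab] := boolP ((a == b.+1 :> nat) || (b == a.+1 :> nat));
  last first.
  (* An insertion never brings two values closer, so a pair that is not adjacent cannot become
     so. *)
  apply: eq_card0 => j; rewrite inE; apply/negbTE.
  by move: ab; rewrite /bump; do 2 case: leqP => /=; lia.
(* The pair is separated exactly when [j] equals its larger value, which is then pushed up alone. *)
have c_lt : (maxn a b < m.+2)%N by lia.
have := cardsC1 (Ordinal c_lt); rewrite card_ord mul1n; apply: etrans.
apply: eq_card => j; rewrite !inE -val_eqE /=.
by move: ab; rewrite /bump; do 2 case: leqP => /=; lia.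
Qed.

End LastInsertion.

(** * Recurrences and closed forms of the counts *)

Definition nb_well s n := #|[set q : 'S_n | meets_well s q]%SET|.
Definition nb_never s n := #|[set q : 'S_n | never_meets s q]%SET|.

Lemma sum_nat_pred (T : finType) (P : pred T) :
  (\sum_x nat_of_bool (P x))%N = #|[set x | P x]%SET|.
Proof.
by rewrite -sum1dep_card [RHS]big_mkcond; apply: eq_bigr => x; case: P.
Qed.

Lemma nb_neverS s m : (0 < s <= m.+1)%N ->
  nb_never s m.+2 = (nb_never s m.+1 * m)%N.
Proof.
move=> /andP[s0 sm]; rewrite /nb_never card_perm_lift.
under eq_bigr => q _ do rewrite card_never_meets_lift //.
by rewrite -big_distrl sum_nat_pred.
Qed.

Lemma nb_wellS s m : (0 < s <= m.+1)%N ->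
  nb_well s m.+2 = (nb_well s m.+1 * m.+1 + nb_never s m.+1 * 2)%N.
Proof.
move=> /andP[s0 sm]; rewrite /nb_never /nb_well card_perm_lift.
under eq_bigr => q _ do rewrite card_meets_well_lift //.
by rewrite big_split -!big_distrl !sum_nat_pred.
Qed.

(* The number of applicants is [s.+2 + k], to avoid truncated subtractions. *)
Lemma nb_closed s k :
  nb_never s.+2 (s.+2 + k) = (s.+2 * s.+1 * (s + k)`!)%N /\
  nb_well s.+2 (s.+2 + k) = (2 * s.+2 * k * (s + k)`!)%N.
Proof.
elim: k => [|k [IHn IHw]].
  (* For [k = 0] the threshold equals the number of applicants, so no position reaches it. *)
  have nm (u : 'I_(s.+2 + 0) -> 'I_(s.+2 + 0)) i : meets s.+2 u i = false.
    by rewrite /meets leqNgt -[X in (_ < X)%N]addn0 ltn_ord.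
  split.
    rewrite /nb_never (_ : [set _ | _]%SET = [set: 'S_(s.+2 + 0)]%SET).
      by rewrite cardsT card_Sn !addn0 !factS mulnA.
    by apply/setP => q; rewrite !inE; apply/forallP => i; rewrite nm.
  rewrite muln0 mul0n; apply: eq_card0 => q; rewrite inE.
  by apply/existsP => -[i /andP[/andP[]]]; rewrite nm.
rewrite !addnS !addSn in IHn IHw *.
have sk : (0 < s.+2 <= (s + k).+2)%N by rewrite !ltnS leq_addr.
rewrite (nb_neverS sk) (nb_wellS sk) IHn IHw factS.
by split; nia.
Qed.

(** * From orderings of applicants to permutations, and the exact probability *)

Lemma card_orderings_with n {d} (T : finOrderType d) (P : pred ('I_n -> T))
    (g : 'I_n -> T) : bijective g ->
  #|[set x in orderings n T | P x]%SET| = #|[set q : 'S_n | P (g \o q)]%SET|.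
Proof.
move=> [h gK hK].
pose F (q : 'S_n) : {ffun 'I_n -> T} := [ffun i => g (q i)].
have F_inj : injective F.
  move=> q q' /ffunP e; apply/permP => i; apply: (can_inj gK).
  by have := e i; rewrite !ffunE.
have FE q : F q = g \o q :> ('I_n -> T) by apply/funext => i; rewrite /F ffunE.
rewrite -(card_imset [set q : 'S_n | P (g \o q)]%SET F_inj).
apply: eq_card => x; rewrite !inE.
apply/andP/imsetP => [[/injectiveP xi Px]|[q]].
  have hx_inj : injective (h \o x) by move=> i j /(can_inj hK) /xi.
  exists (perm hx_inj); last by apply/ffunP => i; rewrite /F ffunE permE /= hK.
  rewrite inE (_ : g \o _ = x) //; apply/funext => i /=.
  by rewrite permE /= hK.
rewrite inE -FE => PF ->; split => //; apply/injectiveP => i j.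
by rewrite /F !ffunE => /(can_inj gK) /perm_inj.
Qed.

Lemma monotone_enum n {d} (T : finOrderType d) : #|T| = n ->
  exists g : 'I_n -> T, {mono g : x y / (x <= y)%O} /\ bijective g.
Proof.
move=> <-; exists (@Order.enum_val d T predT); split.
  exact: Order.EnumVal.le_enum_val (@le_total _ _) predT.
exact: Order.enum_val_bij.
Qed.

Lemma p_tauE (R : realType) n s {d} (T : finOrderType d) (alpha : R) :
  #|T| = n -> (forall k : 'I_n, (alpha * n%:R < k%:R) = (s <= k)%N) ->
  p_tau n T alpha = (nb_well s n)%:R / (n`!)%:R.
Proof.
move=> cT sP; have [g [g_mono g_bij]] := monotone_enum cT.
rewrite /p_tau; congr (_%:R / _%:R).
  rewrite (_ : [set x in _ | _]%SET
    = [set x : {ffun 'I_n -> T} in orderings n T | meets_well s x]%SET);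
    last first.
    by apply/setP => x; rewrite !inE (successE _ sP).
  rewrite (card_orderings_with (meets_well s) g_bij).
  by apply: eq_card => q; rewrite !inE meets_well_mono.
rewrite (_ : orderings n T
  = [set x : {ffun 'I_n -> T} in orderings n T | xpredT (x : 'I_n -> T)]%SET);
  last first.
  by apply/setP => x; rewrite !inE andbT.
rewrite (card_orderings_with xpredT g_bij) -card_Sn.
by apply: eq_card => q; rewrite inE.
Qed.

(** Here [s] is the least integer above [alpha * n], and the last factor is [n / (n - 1)], left over
    from [(n - 2)! / n!]. *)
Lemma p_tau_closed (R : realType) n {d} (T : finOrderType d) (alpha : R) :
  #|T| = n -> 0 < alpha < 1 -> 1 <= alpha * n%:R ->
  let s := (Num.trunc (alpha * n%:R)).+1 in
  p_tau n T alpha = 2 * (s%:R / n%:R) * (1 - s%:R / n%:R) * (1 + n.-1%:R^-1).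
Proof.
move=> cT /andP[a0 a1] an1 s.
have an0 : 0 <= alpha * n%:R by lra.
have n0 : (0 < n)%N by case: n an1 {cT s an0} => //; rewrite mulr0 ler10.
rewrite (@p_tauE _ _ s) //; last first.
  by move=> k; rewrite /s truncn_lt_nat.
(* The hypothesis [1 <= alpha * n] gives [s] at least 2, the form required by [nb_closed]. *)
have [t st] : exists t, s = t.+2.
  rewrite /s; have := truncn_gt0 (alpha * n%:R); rewrite an1.
  by case: Num.trunc => // t; exists t.
have sn : (s <= n)%N.
  by rewrite /s truncn_lt_nat // gtr_pMl // ltr0n.
rewrite st in sn *; have [k nE] : exists k, n = (t.+2 + k)%N.
  by exists (n - t.+2)%N; lia.
rewrite nE (nb_closed t k).2 !addSn !factS /= !natrM.
have f0 : ((t + k)`!)%:R != 0 :> R by rewrite pnatr_eq0 -lt0n fact_gt0.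
rewrite -!natr1 natrD.
have t0 : 0 <= t%:R :> R by []; have k0 : 0 <= k%:R :> R by [].
by field; rewrite f0 !lt0r_neq0 // ltr_wpDl // addr_ge0.
Qed.

(** * The limit and its maximum *)

Lemma cvg_p_tau (R : realType) d (A : nat -> finOrderType d)
    (card_A : forall n : nat, (3 < n)%N -> #|A n| = n) (alpha : R) :
  0 < alpha < 1 ->
  p_tau n (A n) alpha @[n --> \oo] --> 2 * alpha * (1 - alpha).
Proof.
move=> alpha01; have /andP[a0 a1] := alpha01.
pose r n : R := (Num.trunc (alpha * n%:R)).+1%:R / n%:R.
have inv0 : (n%:R^-1 : R) @[n --> \oo] --> (0 : R).
  by rewrite -cvg_shiftS; exact: cvg_harmonic.
have invp0 : (n.-1%:R^-1 : R) @[n --> \oo] --> (0 : R).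
  by rewrite -cvg_shiftS; exact: inv0.
have r_cvg : r n @[n --> \oo] --> alpha.
  (* The numerator of [r n] lies between [alpha * n] and [alpha * n + 1]. *)
  apply: (@squeeze_cvgr _ _ _ _ (fun=> alpha) (fun n => alpha + n%:R^-1)).
  - near=> n.
    have n0 : 0 < n%:R :> R by rewrite ltr0n; near: n; exists 1%N.
    have an0 : 0 <= alpha * n%:R by rewrite mulr_ge0 // ltW.
    have /andP[tl tg] := truncn_itv an0.
    rewrite /r ler_pdivlMr // (ltW tg) /=.
    rewrite ler_pdivrMr // mulrDl mulVf ?gt_eqF //.
    by rewrite -natr1 lerD2r.
  - exact: cvg_cst.
  - by rewrite -[X in _ --> X]addr0; apply: cvgD => //; exact: cvg_cst.
have lim : 2 * r n * (1 - r n) * (1 + n.-1%:R^-1) @[n --> \oo]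
    --> 2 * alpha * (1 - alpha).
  rewrite -[X in _ --> X]mulr1 -[X in _ * X]addr0.
  apply: cvgM; last by apply: cvgD => //; exact: cvg_cst.
  by apply: cvgM; [apply: cvgMr|apply: cvgB => //; exact: cvg_cst].
apply: cvg_trans lim; apply: near_eq_cvg; near=> n.
rewrite p_tau_closed //.
  by apply: card_A; near: n; exists 4%N.
rewrite mulrC -ler_pdivrMr // div1r.
by near: n; exact: nbhs_infty_ger.
Unshelve. all: by end_near. Qed.

Theorem theorem1p1 (R : realType) (d : Order.disp_t)
    (A : nat -> finOrderType d)
    (card_A : forall n : nat, (3 < n)%N -> #|A n| = n)
    (alpha : R) (alpha_gt0 : 0 < alpha) (alpha_lt1 : alpha < 1) :
  [/\ cvgn (fun n => p_tau n (A n) alpha),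
      cvgn (fun n => p_tau n (A n) (1 / 2 : R)),
      limn (fun n => p_tau n (A n) alpha)
        <= limn (fun n => p_tau n (A n) (1 / 2 : R))
    & limn (fun n => p_tau n (A n) (1 / 2 : R)) = 1 / 2].
Proof.
have alpha01 : 0 < alpha < 1 by rewrite alpha_gt0.
have half01 : 0 < (1 / 2 : R) < 1 by lra.
have Ca := cvg_p_tau card_A alpha01.
have Ch := cvg_p_tau card_A half01.
have -> := cvg_lim (@Rhausdorff R) Ca; have -> := cvg_lim (@Rhausdorff R) Ch.
split => //; last by field.
(* The gap [1 / 2 - 2 * alpha * (1 - alpha)] is twice this square. *)
by have := sqr_ge0 (alpha - 1 / 2); rewrite expr2; lra.
Qed.
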